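(* Let $V$ and $W$ be real Hilbert spaces, let $F\colon V\to\overline{\mathbb{R}}$ and $G\colon W\to\overline{\mathbb{R}}$ be proper, convex, and lower semicontinuous functions, and let $B\colon V\to W$ be a bounded linear operator. Consider the primal problem $$\min_{v\in V}\{F(v)+G(Bv)\}$$ and the dual problem $$\min_{q\in W^*}\{F^*(-B^*q)+G^*(q)\}.$$ Suppose that the following hold: (i) The primal problem admits a solution $u\in V$. (ii) The function $H\colon W\to\overline{\mathbb{R}}$, $H(w)=\inf_{v\in V}\{F(v)+G(Bv+w)\}$, is subdifferentiable at $w=0$, which ensures that the dual problem admits a solution $p\in W^*$. (iii) The function $F$ is $\mu$-strongly convex for some $\mu>0$. If an iterative method $\{u^{(n)}\}\subset V$ for solving the primal problem is a dualization of an iterative method $\{p^{(n)}\}\subset W^*$ for solving the dual problem, i.e., the corresponding iterates satisfy $$-B^*p^{(n)}\in\partial F(u^{(n)}),\quad n\geq 1,$$ then $$\|u^{(n)}-u\|\leq\mu^{-1}\|B^*(p^{(n)}-p)\|,\quad n\geq 1.$$ In particular, if $p^{(n)}\to p$ in $W^*$, then $u^{(n)}\to u$ in $V$.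
   Context: Notation: $\overline{\mathbb{R}}=\mathbb{R}\cup\{\pm\infty\}$; $V^*,W^*$ are the dual spaces; $(\cdot,\cdot)$ denotes inner products and duality pairings; $\|\cdot\|$ denotes the norm of the space in question; $B^*\colon W^*\to V^*$ is the adjoint, $(q,Bv)=(B^*q,v)$. The effective domain is $\operatorname{dom}F=\{v:F(v)<\infty\}$. $F$ is proper if $\operatorname{dom}F\ne\emptyset$ and $F$ never takes the value $-\infty$. For convex $F$ and $w\in\operatorname{dom}F$, the subdifferential is $\partial F(w)=\{q\in V^*: F(v)\ge F(w)+(q,v-w)\text{ for all }v\in V\}$; $F$ is subdifferentiable at $w$ if $\partial F(w)\neq\emptyset$ (and similarly for functions on $W$). The Legendre--Fenchel conjugate is $F^*(q)=\sup_{v\in V}\{(q,v)-F(v)\}$, $q\in V^*$ (and similarly $G^*$ on $W^*$). $F$ is $\mu$-strongly convex if $F(v)\ge F(w)+(q,v-w)+\frac{\mu}{2}\|v-w\|^2$ for all $v\in V$, all $w\in\operatorname{dom} F$ and all $q\in\partial F(w)$. Dualization (definition): an iterative method $\{u^{(n)}\}\subset V$ for the primal problem is a dualization of an iterative method $\{p^{(n)}\}\subset W^*$ for the dual problem if, for any initial configuration of the dual algorithm, there exists an initial configuration of the primal algorithm such that $-B^*p^{(n)}\in\partial F(u^{(n)})$ for all $n\geq1$. *)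

(* Defs.v *)
From HB Require Import structures.
From mathcomp Require Import all_boot all_order all_algebra.
From mathcomp Require Import all_classical all_reals all_analysis.

Set Implicit Arguments.
Unset Strict Implicit.
Unset Printing Implicit Defensive.

Import Order.TTheory GRing.Theory Num.Theory.
Import numFieldNormedType.Exports.
Local Open Scope classical_set_scope.
Local Open Scope ring_scope.

HB.mixin Record CompleteNormedModule_isHilbert (R : realType) V
    of CompleteNormedModule R V := {
  inner : {dot V for (@idfun R)};
  normr_inner : forall x : V, `|x| ^+ 2 = inner x x
}.

#[short(type="hilbertType")]
HB.structure Definition Hilbert (R : realType) :=
  {V of CompleteNormedModule R V & CompleteNormedModule_isHilbert R V}.

Section bounded_operators.
Context {R : realType} {V W : normedModType R}.
Implicit Types f g : V -> W.

Definition bounded_linear f : Prop :=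
  linear f /\ exists M : R, forall v, `|f v| <= M * `|v|.

Definition bopP : {pred V -> W} := mem [set f | bounded_linear f].

(* The proof component is boolean so that equality of operators is equality of
   the underlying functions. *)
Record bop := Bop { bop_fun :> V -> W; bop_funP : bop_fun \in bopP }.

HB.instance Definition _ := [isSub for bop_fun].
HB.instance Definition _ := [Choice of bop by <:].

Lemma bounded_linear_bop (F : bop) : bounded_linear F.
Proof. exact: set_mem (bop_funP F). Qed.

Lemma bop_submod_closed : submod_closed bopP.
Proof.
split=> [|a f g /set_mem[lf [M fM]] /set_mem[lg [N gN]]]; apply: mem_set.
  split=> [a x y /=|]; first by rewrite scaler0 addr0.
  by exists 0 => v; rewrite normr0 mul0r.
split=> [b x y|].
  change (a *: f (b *: x + y) + g (b *: x + y) =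
    b *: (a *: f x + g x) + (a *: f y + g y)).
  by rewrite lf lg !scalerDr !scalerA mulrC addrACA.
exists (`|a| * M + N) => v.
change (`|a *: f v + g v| <= (`|a| * M + N) * `|v|).
rewrite (le_trans (ler_normD _ _))// mulrDl lerD// normrZ -mulrA.
exact: ler_wpM2l.
Qed.

HB.instance Definition _ :=
  GRing.isSubmodClosed.Build _ _ bopP bop_submod_closed.
HB.instance Definition _ := [SubChoice_isSubLmodule of bop by <:].

Definition bop_norm (F : bop) : R :=
  sup [set `|F v| | v in [set v : V | `|v| <= 1]].

Lemma bop_norm_has_sup (F : bop) :
  has_sup [set `|F v| | v in [set v : V | `|v| <= 1]].
Proof.
have [lF [M FM]] := bounded_linear_bop F; split.
  by exists `|F 0|, 0 => //=; rewrite normr0.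
exists `|M| => _ [v /= v1 <-]; rewrite (le_trans (FM v))//.
by rewrite (le_trans (ler_norm _))// normrM normr_id ler_piMr.
Qed.

Lemma ler_bop_unit (F : bop) v : `|v| <= 1 -> `|F v| <= bop_norm F.
Proof.
by move=> v1; apply: sup_upper_bound; [exact: bop_norm_has_sup|exists v].
Qed.

Lemma bop_norm_le (F : bop) (M : R) :
  (forall v, `|v| <= 1 -> `|F v| <= M) -> bop_norm F <= M.
Proof.
move=> FM; apply: ge_sup; first by have [] := bop_norm_has_sup F.
by move=> _ [v /= v1 <-]; exact: FM.
Qed.

Lemma ler_bop_normD (F G : bop) : bop_norm (F + G) <= bop_norm F + bop_norm G.
Proof.
apply: bop_norm_le => v v1; rewrite (le_trans (ler_normD _ _))//.
by rewrite lerD// ler_bop_unit.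
Qed.

Lemma bop_norm_ge0 (F : bop) : 0 <= bop_norm F.
Proof. by rewrite (le_trans _ (@ler_bop_unit F 0 _))// normr0. Qed.

Lemma bop_normZ (l : R) (F : bop) : bop_norm (l *: F) = `|l| * bop_norm F.
Proof.
have leZ k G : bop_norm (k *: G) <= `|k| * bop_norm G.
  by apply: bop_norm_le => v v1; rewrite normrZ ler_wpM2l// ler_bop_unit.
apply/eqP; rewrite eq_le leZ/=.
have [->|l0] := eqVneq l 0; first by rewrite normr0 mul0r bop_norm_ge0.
rewrite -ler_pdivlMl ?normr_gt0// -normfV.
by rewrite -[in leLHS](scalerK l0 F) leZ.
Qed.

Lemma bop_norm_eq0 (F : bop) : bop_norm F = 0 -> F = 0.
Proof.
move=> F0; apply/val_inj/funext => v.
have [lF _] := bounded_linear_bop F.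
have F00 : F 0 = 0.
  have /eqP := lF 1 0 0; rewrite !scale1r addr0 -subr_eq0 opprD addrA subrr.
  by rewrite sub0r oppr_eq0 => /eqP.
have FZ a x : F (a *: x) = a *: F x.
  by have := lF a x 0; rewrite F00 !addr0.
change (F v = 0); have [->//|v0] := eqVneq v 0.
have : `|F (`|v|^-1 *: v)| <= 0.
  rewrite -F0 ler_bop_unit// normrZ normfV normr_id mulVf//.
  by rewrite normr_eq0.
rewrite FZ normr_le0 scaler_eq0 invr_eq0 normr_eq0 (negbTE v0)/=.
by move=> /eqP.
Qed.

HB.instance Definition _ :=
  Lmodule_isNormed.Build R bop ler_bop_normD bop_normZ bop_norm_eq0.

End bounded_operators.
Arguments bop {R} V W.

Definition dual_space {R : realType} (V : normedModType R) := bop V R^o.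

Section adjoint.
Context {R : realType} {V W : normedModType R} (B : bop V W).

Lemma adjoint_subproof (q : dual_space W) : (q \o B : V -> R^o) \in bopP.
Proof.
have [lB [M BM]] := bounded_linear_bop B.
have [lq [N qN]] := bounded_linear_bop q.
apply: mem_set; split=> [a x y|]; first by rewrite /= lB lq.
exists (`|N| * M) => v; rewrite /= (le_trans (qN _))// -mulrA.
by rewrite (@le_trans _ _ (`|N| * `|B v|))// ?ler_wpM2r ?ler_wpM2l// ler_norm.
Qed.

Definition adjoint (q : dual_space W) : dual_space V := Bop (adjoint_subproof q).

End adjoint.

Section convex_analysis.
Context {R : realType} {V : normedModType R}.
Implicit Types (F : V -> \bar R) (w : V) (q : dual_space V).
Local Open Scope ereal_scope.

Definition dom F : set V := [set v | F v < +oo].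

Definition proper_efun F : Prop := dom F !=set0 /\ forall v, F v != -oo.

(* [x +? y] holds unless the sum is of the form oo - oo. *)
Definition convex_efun F : Prop := forall (x y : V) (t : R), (0 <= t <= 1)%R ->
  t%:E * F x +? (1 - t)%:E * F y ->
  F (t *: x + (1 - t) *: y)%R <= t%:E * F x + (1 - t)%:E * F y.

Definition subdifferential F w : set (dual_space V) :=
  [set q | dom F w /\ forall v, F w + (q (v - w)%R)%:E <= F v].

Definition subdifferentiable F w : Prop := subdifferential F w !=set0.

Definition conjugate F q : \bar R :=
  ereal_sup [set (q v)%:E - F v | v in [set: V]].

Definition strongly_convex (mu : R) F : Prop :=
  forall v w q, dom F w -> subdifferential F w q ->
  F w + (q (v - w)%R)%:E + (mu / 2 * `|v - w| ^+ 2)%:E <= F v.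

End convex_analysis.

Definition minimizer {R : realType} {T : Type} (J : T -> \bar R) (x : T) : Prop :=
  forall y, (J x <= J y)%E.

Section duality.
Context {R : realType} {V W : normedModType R}.
Variables (F : V -> \bar R) (G : W -> \bar R) (B : bop V W).
Local Open Scope ereal_scope.

Definition primal (v : V) : \bar R := F v + G (B v).

Definition dual_functional (q : dual_space W) : \bar R :=
  conjugate F (- adjoint B q)%R + conjugate G q.

Definition perturbation (w : W) : \bar R :=
  ereal_inf [set F v + G (B v + w)%R | v in [set: V]].

End duality.

(* A method is abstracted to the sequence of iterates it produces from each of
   its initial configurations. *)
Record iterative_method (X : Type) := IterativeMethod {
  config : Type;
  iterates : config -> nat -> X
}.

Section dualization.
Context {R : realType} {V W : normedModType R}.
Variables (F : V -> \bar R) (B : bop V W).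

Definition dual_iterates (u : nat -> V) (p : nat -> dual_space W) : Prop :=
  forall n, (1 <= n)%N -> subdifferential F (u n) (- adjoint B (p n)).

Definition dualization (U : iterative_method V)
    (P : iterative_method (dual_space W)) : Prop :=
  forall d : config P, exists c : config U,
    dual_iterates (iterates c) (iterates d).

End dualization.

(* Main.v *)
Require Import Defs.
From HB Require Import structures.
From mathcomp Require Import all_boot all_order all_algebra.
From mathcomp Require Import all_classical all_reals all_analysis.
From mathcomp Require Import lra.

(** Fenchel-Rockafellar duality puts [- adjoint B p] in the subdifferential of
    [F] at the primal solution [u], for every dual solution [p]; the estimate
    then compares two subgradients of one strongly convex function.

    Let [m] be the primal minimum; subdifferentiability of the perturbation
    function at [0] makes it finite.  Adding the Fenchel-Young inequalities for
    [F] at [u] and for [G] at [B u], where the pairings with [p] cancel, bounds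
    every dual value below by [- m] ([weak_duality]).  A subgradient [q] of the
    perturbation function at [0] satisfies [m + q z - q (B v) <= F v + G z] for
    all [v] and [z]; taking the supremum over [v] and [z] shows that its dual
    value is at most [- m] ([strong_duality]).  So [q] is a dual solution and
    the dual minimum is [- m].  At any dual solution [p] the two Fenchel-Young
    inequalities therefore hold with equality, and equality for [F] says that
    [- adjoint B p] is a subgradient of [F] at [u]
    ([subdifferential_of_dual_le]).

    Strong convexity makes the subdifferential strongly monotone, so distances
    between points are at most [mu^-1] times distances between subgradients
    ([subdifferential_dist]).  For the iterates, the subgradients are
    [- adjoint B (p n)] and [- adjoint B p].  Convergence follows since
    the adjoint is bounded. *)

Set Implicit Arguments.
Unset Strict Implicit.
Unset Printing Implicit Defensive.

Import Order.TTheory GRing.Theory Num.Theory.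
Import numFieldNormedType.Exports.
Local Open Scope classical_set_scope.
Local Open Scope ring_scope.

Section bounded_operators.
Context {R : realType} {V W : normedModType R}.

(** Linearity is carried by a boolean membership proof; registering it gives
    access to the generic theory of linear maps. *)
HB.instance Definition _ (f : bop V W) :=
  GRing.isLinear.Build R V W *:%R (bop_fun f) (bounded_linear_bop f).1.

Lemma ler_bop_norm (f : bop V W) v : `|f v| <= `|f| * `|v|.
Proof.
have [->|v0] := eqVneq v 0; first by rewrite linear0 !normr0 mulr0.
have nv0 : 0 < `|v| by rewrite normr_gt0.
have : `|f (`|v|^-1 *: v)| <= `|f|.
  by apply: ler_bop_unit; rewrite normrZ normfV normr_id mulVf// gt_eqF.
by rewrite linearZ/= normrZ normfV normr_id mulrC ler_pdivrMr.
Qed.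

End bounded_operators.

Section adjoint.
Context {R : realType} {V W : normedModType R}.

Lemma adjointB (B : bop V W) (p q : dual_space W) :
  adjoint B (p - q) = adjoint B p - adjoint B q.
Proof. exact/val_inj. Qed.

Lemma ler_norm_adjoint (B : bop V W) (q : dual_space W) :
  `|adjoint B q| <= `|q| * `|B|.
Proof.
apply: bop_norm_le => v v1; rewrite (le_trans (ler_bop_norm q (B v)))//.
by rewrite ler_wpM2l// ler_bop_unit.
Qed.

End adjoint.

Section subdifferential.
Context {R : realType} {V : normedModType R}.
Implicit Types (F : V -> \bar R) (w : V) (q : dual_space V).

Lemma fenchel_young F q v : ((q v)%:E - F v <= conjugate F q)%E.
Proof. by apply: ereal_sup_ubound; exists v. Qed.

Lemma subdifferential_fin_num F w q :
  proper_efun F -> subdifferential F w q -> F w \is a fin_num.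
Proof. by move=> [_ FNy] [Fw _]; rewrite fin_numE FNy lt_eqF. Qed.

(** The equality case of the Fenchel-Young inequality characterizes subgradients:
    the supremum defining the conjugate is then attained at [w]. *)
Lemma conjugate_subdifferential F w q : F w \is a fin_num ->
  (conjugate F q <= (q w)%:E - F w)%E -> subdifferential F w q.
Proof.
move=> Fw conjF; split; first by rewrite /dom/= -(fineK Fw) ltry.
move=> v; have := le_trans (fenchel_young F q v) conjF.
rewrite -(fineK Fw) linearB/=.
case: (F v) => [r| |] //=; rewrite ?leey// -?EFinB -?EFinD ?lee_fin//.
lra.
Qed.

(** Adding the two strong convexity inequalities, each based at one of the points
    and tested at the other, cancels the values of [F] and leaves
    [mu * |x - y|^2 <= (p - q) (x - y)]; the dual norm bounds the right side. *)
Lemma subdifferential_dist F (mu : R) x y p q : proper_efun F -> 0 < mu ->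
  strongly_convex mu F -> subdifferential F x p -> subdifferential F y q ->
  `|x - y| <= mu^-1 * `|p - q|.
Proof.
move=> properF mu0 sF Fxp Fyq.
have Fx := subdifferential_fin_num properF Fxp.
have Fy := subdifferential_fin_num properF Fyq.
have := sF x y q Fyq.1 Fyq; have := sF y x p Fxp.1 Fxp.
rewrite -(fineK Fx) -(fineK Fy) -!EFinD !lee_fin -[y - x]opprB normrN linearN/=.
move=> yx xy.
have pqE : (p - q) (x - y) = p (x - y) - q (x - y) by [].
have mono : mu * `|x - y| * `|x - y| <= `|p - q| * `|x - y|.
  apply: le_trans (ler_bop_norm (p - q) _); apply: le_trans (ler_norm _).
  rewrite pqE; lra.
rewrite ler_pdivlMl//; have [->|xy0] := eqVneq (x - y) 0.
  by rewrite normr0 mulr0.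
by rewrite -(ler_pM2r (_ : 0 < `|x - y|)) ?normr_gt0.
Qed.

End subdifferential.

Section duality.
Context {R : realType} {V W : normedModType R}.
Variables (F : V -> \bar R) (G : W -> \bar R) (B : bop V W).
Hypotheses (properF : proper_efun F) (properG : proper_efun G).

(** The perturbation function at [0] is the primal infimum, attained at [u], and
    having a subgradient there includes being [< +oo]; properness excludes
    [-oo]. *)
Lemma minimizer_primal_fin_num u :
  minimizer (primal F G B) u -> subdifferentiable (perturbation F G B) 0 ->
  F u \is a fin_num /\ G (B u) \is a fin_num.
Proof.
move=> minu [q [H0 _]].
have : (primal F G B u < +oo)%E.
  apply: le_lt_trans H0; apply: le_ereal_inf_tmp => _ [v _ <-].
  by rewrite addr0; exact: minu.
rewrite /primal; have := properF.2 u; have := properG.2 (B u).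
by case: (F u) => [r| |]; case: (G (B u)) => [s| |].
Qed.

Section finite_minimizer.
Variable u : V.
Hypotheses (Fu : F u \is a fin_num) (Gu : G (B u) \is a fin_num).

(** The left side is a sum of two conjugates, each bounded below by
    Fenchel-Young, and the two lower bounds add up to the right side.  Hence both
    inequalities are equalities. *)
Lemma subdifferential_of_dual_le p : (dual_functional F G B p <= - primal F G B u)%E ->
  subdifferential F u (- adjoint B p).
Proof.
move=> dualp; apply: conjugate_subdifferential => //.
have := fenchel_young F (- adjoint B p) u.
have := fenchel_young G p (B u).
have -> : (- adjoint B p) u = - p (B u) by [].
move: dualp; rewrite /dual_functional /primal -(fineK Fu) -(fineK Gu).
move: (conjugate F _) (conjugate G _) => [a| |] [b| |] //=.
by rewrite !lee_fin; lra.
Qed.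

(** The terms [p (B u)] of the Fenchel-Young inequalities for [F] at [u] and for
    [G] at [B u] have opposite signs. *)
Lemma weak_duality p : (- primal F G B u <= dual_functional F G B p)%E.
Proof.
have := leeD (fenchel_young F (- adjoint B p) u) (fenchel_young G p (B u)).
have -> : (- adjoint B p) u = - p (B u) by [].
apply: le_trans; rewrite /primal -(fineK Fu) -(fineK Gu) lee_fin; lra.
Qed.

(** The subgradient inequality at the perturbation [z - B v] decouples [v] from
    [z], so the suprema over [v] and over [z] that define the two conjugates can
    be taken one after the other. *)
Lemma strong_duality q : minimizer (primal F G B) u ->
  subdifferential (perturbation F G B) 0 q ->
  (dual_functional F G B q <= - primal F G B u)%E.
Proof.
move=> minu [_ Hq].
have key v z : (primal F G B u + (q z - q (B v))%:E <= F v + G z)%E.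
  apply: (@le_trans _ _ (perturbation F G B 0%R + (q (z - B v - 0)%R)%:E)%E).
    rewrite subr0 linearB leeD2r//; apply: le_ereal_inf_tmp => _ [x _ <-].
    by rewrite addr0; exact: minu.
  apply: le_trans (Hq _) _; apply: ereal_inf_lbound; exists v => //.
  by rewrite [B v + _]addrC subrK.
have GNy z := properG.2 z; have FNy v := properF.2 v.
have evalF v : (- adjoint B q) v = - q (B v) by [].
have lbF := fenchel_young F (- adjoint B q)%R u.
have ubF z : (G z < +oo -> conjugate F (- adjoint B q)%R <=
    G z - primal F G B u - (q z)%:E)%E.
  move=> Gz; apply: ge_ereal_sup => _ [v _ <-]; rewrite evalF.
  have := key v z; move: Gz (GNy z) (FNy v).
  rewrite /primal -(fineK Fu) -(fineK Gu).
  case: (G z) => [b| |] //; case: (F v) => [a| |] // _ _ _;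
    last by move=> _; exact: leNye.
  by rewrite -!EFinD !lee_fin; lra.
(* Finiteness allows moving this term across the inequality below; the upper
   bound comes from [z = B u], where [G] is finite. *)
have conjF : conjugate F (- adjoint B q)%R \is a fin_num.
  have := ubF (B u); move: lbF; rewrite /primal -(fineK Fu) -(fineK Gu) evalF.
  by case: (conjugate F _) => // _ /(_ (ltry _)).
suff : (conjugate G q <= - primal F G B u - conjugate F (- adjoint B q)%R)%E.
  rewrite /dual_functional /primal -(fineK conjF) -(fineK Fu) -(fineK Gu).
  case: (conjugate G _) => [b| |] //; last by move=> _; exact: leNye.
  by rewrite -!EFinD !lee_fin; lra.
apply: ge_ereal_sup => _ [z _ <-].
have := ubF z; move: (GNy z).
rewrite /primal -(fineK conjF) -(fineK Fu) -(fineK Gu).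
case: (G z) => [b| |] // _; last by move=> _; exact: leNye.
by move=> /(_ (ltry _)); rewrite -!EFinD !lee_fin; lra.
Qed.

End finite_minimizer.

End duality.

Theorem theorem3p5 (R : realType) (V W : hilbertType R)
  (F : V -> \bar R) (G : W -> \bar R) (B : bop V W)
  (properF : proper_efun F) (convexF : convex_efun F) (lscF : lower_semicontinuous F)
  (properG : proper_efun G) (convexG : convex_efun G) (lscG : lower_semicontinuous G)
  (u : V) (solu : minimizer (primal F G B) u)
  (subdiffH : subdifferentiable (perturbation F G B) 0)
  (mu : R) (mu0 : 0 < mu) (sconvF : strongly_convex mu F) :
  (exists p : dual_space W, minimizer (dual_functional F G B) p) /\
  forall p : dual_space W, minimizer (dual_functional F G B) p ->
  forall (U : iterative_method V) (P : iterative_method (dual_space W)),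
  dualization F B U P ->
  forall (c : config U) (d : config P),
  dual_iterates F B (iterates c) (iterates d) ->
  (forall n, (1 <= n)%N ->
     `|iterates c n - u| <= mu^-1 * `|adjoint B (iterates d n - p)|) /\
  (iterates d n @[n --> \oo] --> p -> iterates c n @[n --> \oo] --> u).
Proof.
have [Fu Gu] := minimizer_primal_fin_num properF properG solu subdiffH.
have [q Hq] := subdiffH.
have dualq := strong_duality properF properG Fu Gu solu Hq.
split; first by exists q => r; apply: le_trans dualq (weak_duality Fu Gu r).
move=> p minp U P _ c d cd.
have Fup := subdifferential_of_dual_le Fu Gu (le_trans (minp q) dualq).
have est n : (1 <= n)%N ->
    `|iterates c n - u| <= mu^-1 * `|adjoint B (iterates d n - p)|.
  move=> n1; have := subdifferential_dist properF mu0 sconvF (cd n n1) Fup.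
  by rewrite adjointB -opprD normrN.
split=> // dp; apply/subr_cvg0/norm_cvg0P.
have dp0 : `|iterates d n - p| @[n --> \oo] --> 0 by exact/norm_cvg0P/subr_cvg0.
have bnd0 : mu^-1 * (`|iterates d n - p| * `|B|) @[n --> \oo] --> 0.
  rewrite -[X in _ --> X](mulr0 mu^-1) -(mul0r `|B|).
  by apply: cvgMl_tmp; apply: cvgMr_tmp.
apply: squeeze_cvgr (cvg_cst 0) bnd0; near=> n; rewrite normr_ge0/=.
apply: (le_trans (est n _)); first by near: n; exact: nbhs_infty_ge.
by rewrite ler_pM2l ?invr_gt0// ler_norm_adjoint.
Unshelve. all: by end_near. Qed.
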